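(* Let $\mathcal{B}$ be a building set on a finite set $X$, let $\mathcal{C}$ be its generating collection and $\mathcal{C}_{\min}$ the collection of inclusion-minimal elements of $\mathcal{C}$. Then $\Psi(\mathcal{B})=\Psi(\mathcal{C}_{\min})$, where the right side is the chromatic symmetric function of the hypergraph $\mathcal{C}_{\min}$ on $X$.
   Context: A building set on a finite set $X$ is a collection $\mathcal{B}$ of nonempty subsets of $X$ such that (B1) if $S,S'\in\mathcal{B}$ and $S\cap S'\neq\emptyset$ then $S\cup S'\in\mathcal{B}$, and (B2) $\{i\}\in\mathcal{B}$ for all $i\in X$. The restriction is $\mathcal{B}|_I=\{S\in\mathcal{B}:S\subset I\}$; $\mathcal{B}$ is discrete if it has only singletons. For a collection $\mathcal{C}$ of subsets of $X$ each with at least two elements, $\mathcal{B}(\mathcal{C})$ denotes the smallest building set on $X$ containing $\mathcal{C}$ (all unions of sets of $\mathcal{C}$ obtained by repeatedly uniting intersecting sets, plus all singletons). The generating collection of $\mathcal{B}$ is the unique minimal collection $\mathcal{C}$ with $\mathcal{B}=\mathcal{B}(\mathcal{C})$. For a composition $\alpha=(a_1,\dots,a_k)$ of $n=|X|$, $\zeta_\alpha(\mathcal{B})$ is the number of ordered decompositions $X=J_1\sqcup\dots\sqcup J_k$ with $|J_i|=a_i$ and each $\mathcal{B}|_{J_i}$ discrete, and $\Psi(\mathcal{B})=\sum_{\alpha\models n}\zeta_\alpha(\mathcal{B})M_\alpha$, where $M_\alpha=\sum_{i_1<\dots<i_k}x_{i_1}^{a_1}\cdots x_{i_k}^{a_k}$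 are monomial quasi-symmetric functions. A hypergraph on $X$ is any collection $\mathcal{H}$ of subsets of $X$; a proper coloring of $\mathcal{H}$ is a map $f:X\to\mathbb{N}$ that is not constant on any $S\in\mathcal{H}$ with $|S|\geq2$, and $\Psi(\mathcal{H})=\sum_{f\text{ proper}}\prod_{i\in X}x_{f(i)}$. *)

(* Defs.v *)
(* mathcomp-classical supplies finitely supported sums over infinite index sets;
   multinomials' monalg supplies the type [{cmonom nat}] of monomials. *)
From mathcomp Require Import boolp classical_sets functions cardinality fsbigop.
From mathcomp Require Import monalg.
From mathcomp Require Import all_boot all_algebra.

Set Implicit Arguments.
Unset Strict Implicit.
Unset Printing Implicit Defensive.

Import GRing.Theory.

Section BuildingSets.

Variable X : finType.
Implicit Types (B C D H : {set {set X}}) (I S T : {set X}).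

Definition building_set B : bool :=
  [&& set0 \notin B,
      [forall S in B, forall T in B, (S :&: T != set0) ==> (S :|: T \in B)] &
      [forall x : X, [set x] \in B]].

Definition restriction B I : {set {set X}} := [set S in B | S \subset I].

Definition discrete B : bool := [forall S in B, #|S| == 1].

(* The smallest building set containing C, as an intersection; it is indeed a
   building set as soon as set0 \notin C. *)
Definition generated C : {set {set X}} :=
  \bigcap_(B : {set {set X}} | building_set B && (C \subset B)) B.

Definition generates B C : bool :=
  [forall S in C, 1 < #|S|] && (generated C == B).

(* [minset] is inclusion-minimality; existence and uniqueness of the generating
   collection are [generating_collection_exists] and
   [generating_collection_uniq]. *)
Definition generating_collection B C : bool := minset (generates B) C.

Definition minimal_elements C : {set {set X}} :=
  [set S | minset (mem C) S].

(* A sequence (a_1, ..., a_k) of positive integers of sum n; n = 0 has the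
   empty composition. *)
Definition composition (n : nat) (a : seq nat) : bool :=
  (0 \notin a) && (sumn a == n).

Definition decomposition B (a : seq nat)
    (J : {ffun 'I_(size a) -> {set X}}) : bool :=
  [&& [forall i, forall j, (i != j) ==> [disjoint J i & J j]],
      \bigcup_i J i == [set: X],
      [forall i, #|J i| == nth 0 a i] &
      [forall i, discrete (restriction B (J i))]].

Definition zeta B (a : seq nat) : nat :=
  #|[set J : {ffun 'I_(size a) -> {set X}} | decomposition B J]|.

Definition proper_coloring H (f : {ffun X -> nat}) : bool :=
  [forall S in H, (1 < #|S|) ==>
    ~~ [forall x in S, forall y in S, f x == f y]].

Lemma building_setP B :
  reflect [/\ set0 \notin B,
              forall S T, S \in B -> T \in B -> S :&: T != set0 ->
                S :|: T \in B &
              forall x : X, [set x] \in B]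
          (building_set B).
Proof.
apply: (iffP and3P) => -[B0 BU B1]; split => //.
- move=> S T SB TB ST.
  by move/forall_inP/(_ S SB)/forall_inP/(_ T TB)/implyP: BU; apply.
- exact/forallP.
- apply/forall_inP => S SB; apply/forall_inP => T TB; apply/implyP; exact: BU.
- exact/forallP.
Qed.

Lemma generatedP C S :
  reflect (forall B, building_set B -> C \subset B -> S \in B)
          (S \in generated C).
Proof.
apply: (iffP bigcapP) => h B; first by move=> bB CB; apply: h; rewrite bB.
by case/andP; exact: h.
Qed.

Lemma sub_generated C : C \subset generated C.
Proof.
by apply/subsetP => S SC; apply/generatedP => B _ /subsetP; apply.
Qed.

Lemma generated_sub B C :
  building_set B -> C \subset B -> generated C \subset B.
Proof. by move=> bB CB; apply/subsetP => S /generatedP; exact. Qed.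

Lemma generated_building C : set0 \notin C -> building_set (generated C).
Proof.
move=> C0.
have bN0 : building_set [set S : {set X} | S != set0].
  apply/building_setP; split => [|S T|x]; rewrite !inE ?eqxx //.
    by move=> S0 _ _; rewrite setU_eq0 negb_and S0.
  by apply/set0Pn; exists x; rewrite inE.
apply/building_setP; split.
- apply/generatedP => /(_ _ bN0); rewrite !inE eqxx /= => h.
  suff: false by [].
  apply: h; apply/subsetP => S SC; rewrite inE.
  by apply: contraNneq C0 => <-.
- move=> S T /generatedP hS /generatedP hT ST; apply/generatedP => B bB CB.
  case/building_setP: (bB) => _ BU _.
  by apply: BU => //; [exact: hS | exact: hT].
- by move=> x; apply/generatedP => B /building_setP[].
Qed.

Lemma generating_collection_exists B :
  building_set B -> exists C, generating_collection B C.
Proof.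
move=> bB; case/building_setP: (bB) => B0 _ B1.
suff gB : generates B [set S in B | 1 < #|S|].
  by have [C mC _] := minset_exists gB; exists C.
apply/andP; split; first by apply/forall_inP => S; rewrite inE => /andP[].
rewrite eqEsubset generated_sub //=; last first.
  by apply/subsetP => S; rewrite inE => /andP[].
apply/subsetP => S SB; apply/generatedP => B' /building_setP[_ _ B'1].
move/subsetP; case: (ltnP 1 #|S|) => [S1|]; first by apply; rewrite inE SB.
rewrite leq_eqVlt ltnS leqn0 cards_eq0 => /orP[/cards1P[x ->] _|/eqP S0].
  exact: B'1.
by rewrite -S0 SB in B0.
Qed.

Lemma generating_collection_uniq B C D : building_set B ->
  generating_collection B C -> generating_collection B D -> C = D.
Proof.
move=> bB; suff sub C' D' : generating_collection B C' ->
    generating_collection B D' -> C' \subset D'.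
  by move=> mC mD; apply/eqP; rewrite eqEsubset !sub.
move: C' D' => {}C {}D /minsetP[/andP[/forall_inP C2 /eqP gC] minC].
move=> /minsetP[/andP[_ /eqP gD] _].
apply/subsetP => S SC; apply: contraT => SD.
have [_ BU B1] := building_setP _ bB.
have CB : C \subset B by rewrite -gC sub_generated.
have DB : D \subset B by rewrite -gD sub_generated.
have C0 : set0 \notin C :\ S.
  by apply: contraT; rewrite negbK inE => /andP[_ /C2]; rewrite cards0.
have /building_setP[B'0 B'U B'1] := generated_building C0.
set B' := generated (C :\ S) in B'0 B'U B'1.
have CB' T : T \in C -> T != S -> T \in B'.
  by move=> TC TS; apply: (subsetP (sub_generated _)); rewrite !inE TS.
have B'B : B' \subset B.
  by apply: generated_sub => //; apply: subset_trans CB; exact: subsetDl.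
have small T : T \in B -> ~~ (S \subset T) -> T \in B'.
  move=> TB ST; rewrite -gC in TB.
  move/generatedP/(_ [set T in B | (S \subset T) || (T \in B')]): TB.
  rewrite inE (negPf ST) /= => h; suff /andP[//] : (T \in B) && (T \in B').
  apply: h.
    apply/building_setP; split.
    - rewrite inE (negPf B'0) orbF subset0 negb_and.
      by apply/orP; right; rewrite -cards_eq0 -lt0n (ltn_trans _ (C2 _ SC)).
    - move=> U V; rewrite !inE => /andP[UB hU] /andP[VB hV] UV.
      rewrite BU //=.
      case/orP: hU => [SU|UB']; first by rewrite (subset_trans SU) ?subsetUl.
      case/orP: hV => [SV|VB']; first by rewrite (subset_trans SV) ?subsetUr.
      by rewrite B'U ?orbT.
    - by move=> x; rewrite inE B1 B'1 orbT.
  apply/subsetP => U UC; rewrite inE (subsetP CB) //=.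
  by case: (eqVneq U S) => [->|US]; rewrite ?subxx // (CB' U) ?orbT.
have SB' : S \in B'.
  have SB := subsetP CB _ SC; rewrite -gD in SB.
  move/generatedP/(_ [set T in B | (T != S) || (S \in B')]): SB.
  rewrite inE eqxx /= => h; suff /andP[//] : (S \in B) && (S \in B').
  apply: h.
    apply/building_setP; split.
    - by have [/negPf B0 _ _] := building_setP _ bB; rewrite inE B0.
    - move=> U V; rewrite !inE => /andP[UB hU] /andP[VB hV] UV.
      rewrite BU //=; case: (boolP (S \in B')) => [|SB']; rewrite ?orbT // orbF.
      rewrite (negPf SB') !orbF in hU hV.
      apply: contra SB' => /eqP US; rewrite -US; apply: B'U => //.
        by apply: small => //; apply: contra hU => SU;
          rewrite eqEsubset SU andbT -US subsetUl.
      by apply: small => //; apply: contra hV => SV;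
        rewrite eqEsubset SV andbT -US subsetUr.
    - move=> x; rewrite inE B1 /=; apply/orP; left.
      by apply: contraTneq (C2 _ SC) => <-; rewrite cards1.
  apply/subsetP => U UD; rewrite inE (subsetP DB) //=.
  by apply/orP; left; apply: contraNneq SD => <-.
have CB'sub : C \subset B'.
  by apply/subsetP => T TC; case: (eqVneq T S) => [->|/CB'->].
have genCS : generates B (C :\ S).
  apply/andP; split.
    by apply/forall_inP => T; rewrite inE => /andP[_ /C2].
  rewrite eqEsubset B'B /= -[in X in X \subset _]gC.
  by apply: generated_sub => //; exact: generated_building.
by move/setP/(_ S): (minC _ genCS (subsetDl _ _)); rewrite !inE eqxx SC.
Qed.

End BuildingSets.

Local Open Scope ring_scope.

(* Formal power series with integer coefficients in the variables x_0, x_1, ...,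
   given by their coefficients at the monomials. *)
Definition fps : Type := {cmonom nat} -> int.

Definition fps_monomial (m : {cmonom nat}) : fps := fun m' => (m' == m)%:R.

(* Coefficientwise sum of a possibly infinite family.  Each coefficient is a
   finitely supported sum, which [\sum_(_ \in _)] evaluates correctly only if
   finitely many members of the family contribute to it; this is the case for
   the three families below (for M_a, because compositions have no zero part). *)
Definition fps_sum (T : choiceType) (A : set T) (F : T -> fps) : fps :=
  fun m => \sum_(t \in A) F t m.

(* M_a, summing x_(i_1) ^ a_1 * ... * x_(i_k) ^ a_k over i_1 < ... < i_k. *)
Definition monomial_qsym (a : seq nat) : fps :=
  fps_sum [set i : (size a).-tuple nat | sorted ltn i]%classic
    (fun i => fps_monomial
       (\big[mmul/mone]_(j < size a) expcmn (ucm (tnth i j)) (nth 0%N a j))).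

Definition Psi_building (X : finType) (B : {set {set X}}) : fps :=
  fps_sum [set a : seq nat | composition #|X| a]%classic
    (fun a m => (zeta B a)%:R * monomial_qsym a m).

Definition Psi_hypergraph (X : finType) (H : {set {set X}}) : fps :=
  fps_sum [set f : {ffun X -> nat} | proper_coloring H f]%classic
    (fun f => fps_monomial (\big[mmul/mone]_(x : X) ucm (f x))).

(* Main.v *)
(* Restricted to J, the building set B is discrete iff J contains no member of
   C, because every non-singleton of B = B(C) contains one; equivalently, iff J
   contains no minimal member of C.  So the fibres of a proper coloring of C_min
   with monomial m, taken in increasing order of the colors, are the ordered
   decompositions counted by zeta_a(B), where a lists the nonzero exponents of
   m.
   On the other side, M_a is the only monomial quasi-symmetric function in which
   m occurs, and it occurs there with coefficient 1. *)

Require Import Defs.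
From mathcomp Require Import boolp classical_sets functions cardinality fsbigop.
From mathcomp Require Import finmap monalg.
From mathcomp Require Import all_boot all_algebra.

Set Implicit Arguments.
Unset Strict Implicit.
Unset Printing Implicit Defensive.

Import GRing.Theory.

(** * Discreteness and properness in terms of generators *)

Section Discreteness.

Variable X : finType.
Implicit Types (B C : {set {set X}}) (S T J : {set X}).

(** The singletons together with the nonempty sets that contain a member of [C] already form a
    building set containing [C], so [generated C] lies inside it. *)
Lemma generated_contains_generator C S :
  set0 \notin C -> S \in generated C -> 1 < #|S| ->
  exists2 T, T \in C & T \subset S.
Proof.
move=> C0 /generatedP SgC S2.
pose large (T : {set X}) := [exists U in C, U \subset T].
have /SgC : building_set
    [set T : {set X} | (#|T| == 1) || (T != set0) && large T].
  apply/building_setP; split => [|T U|x]; last by rewrite inE cards1.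
    by rewrite inE cards0 eqxx.
  rewrite !inE => hT hU TU; have [x] := set0Pn _ TU.
  rewrite inE => /andP[xT xU].
  have -> : T :|: U != set0 by apply/set0Pn; exists x; rewrite inE xT.
  case: (boolP (large T)) => [/exists_inP[V VC VT]|lT] /=.
    apply/orP; right; apply/exists_inP; exists V => //.
    by rewrite (subset_trans VT) ?subsetUl.
  case: (boolP (large U)) => [/exists_inP[V VC VU]|lU] /=.
    apply/orP; right; apply/exists_inP; exists V => //.
    by rewrite (subset_trans VU) ?subsetUr.
  (* Neither set contains a member of [C], so both are singletons; sharing [x], they coincide. *)
  move: hT hU; rewrite (negPf lT) (negPf lU) !andbF !orbF.
  move=> /cards1P[t Tt] /cards1P[u Uu]; move: xT xU; rewrite Tt Uu !inE.
  by move=> /eqP <- /eqP <-; rewrite setUid cards1.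
have CB : C \subset [set T : {set X} | (#|T| == 1) || (T != set0) && large T].
  apply/subsetP => T TC; rewrite inE; apply/orP; right.
  rewrite (contraNneq _ C0) => [|<- //]; apply/exists_inP; exists T => //.
by move=> /(_ CB); rewrite inE gtn_eqF //= => /andP[_ /exists_inP].
Qed.

Lemma restriction_discrete B C J : building_set B -> generates B C ->
  discrete (restriction B J) =
  [forall S in minimal_elements C, ~~ (S \subset J)].
Proof.
move=> /building_setP[B0 _ _] /andP[/forall_inP C2 /eqP gC].
have C0 : set0 \notin C by apply/negP => /C2; rewrite cards0.
apply/idP/forall_inP => [/forall_inP dJ S|minJ].
  rewrite inE => /minsetP[SC _]; apply/negP => SJ.
  have := C2 _ SC; rewrite ltn_neqAle eq_sym => /andP[/negP[]].
  by apply: dJ; rewrite inE SJ -gC (subsetP (sub_generated C)).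
apply/forall_inP => S; rewrite inE => /andP[SB SJ].
have S0 : 0 < #|S| by rewrite card_gt0; apply: contraNneq B0 => <-.
rewrite eqn_leq S0 andbT leqNgt; apply/negP => S2.
rewrite -gC in SB; have [T TC TS] := generated_contains_generator C0 SB S2.
have [U minU UT] := @minset_exists _ (mem C) T TC.
have /minJ/negP : U \in minimal_elements C by rewrite inE.
by apply; exact: subset_trans UT (subset_trans TS SJ).
Qed.

(** A nonempty set on which [f] is constant lies inside a single fibre. This brings properness into
    the shape of the criterion in [restriction_discrete], with fibres in the role of [J]. *)
Lemma proper_coloringP C (f : {ffun X -> nat}) :
  {in C, forall S, 1 < #|S|} ->
  reflect (forall k S, S \in C -> ~~ (S \subset [set x | f x == k]))
    (proper_coloring C f).
Proof.
move=> C2; apply: (iffP forall_inP) => [pf k S SC|pf S SC].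
  have /implyP/(_ (C2 S SC)) := pf _ SC; apply: contra => /subsetP Sk.
  apply/forall_inP => x /Sk; rewrite inE => /eqP->.
  by apply/forall_inP => y /Sk; rewrite inE eq_sym.
apply/implyP => S2; have /set0Pn[x xS] : S != set0 by rewrite -card_gt0 ltnW.
apply: contra (pf (f x) S SC) => /forall_inP/(_ x xS)/forall_inP fS.
by apply/subsetP => y /fS; rewrite inE eq_sym.
Qed.

End Discreteness.

(** * Exponents of products of monomials *)

Lemma cm_prodE (T : Type) (r : seq T) (F : T -> {cmonom nat}) k :
  (\big[mmul/mone]_(x <- r) F x) k = \sum_(x <- r) F x k.
Proof. exact: (big_morph (fun m : {cmonom nat} => m k) (cmM k) (cm1 k)). Qed.

Lemma expcmnE (m : {cmonom nat}) n k : expcmn m n k = n * m k.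
Proof.
case: n => [|n]; first exact: onecmE.
elim: n => [|n IHn]; first by rewrite mul1n.
by rewrite [LHS](mulcmE m (expcmn m n.+1)) IHn -mulSn.
Qed.

Lemma coloring_monomialE (X : finType) (f : {ffun X -> nat}) k :
  (\big[mmul/mone]_(x : X) ucm (f x)) k = #|[set x | f x == k]|.
Proof.
rewrite cm_prodE -sum1_card [RHS]big_mkcond; apply: eq_bigr => x _.
by rewrite (ucmE (f x)) inE; case: (f x == k).
Qed.

(** Since the entries of [i] are distinct, at most one factor involves the variable [k]. *)
Lemma composition_monomialE (a : seq nat) (i : (size a).-tuple nat) k :
  uniq i ->
  (\big[mmul/mone]_(j < size a) expcmn (ucm (tnth i j)) (nth 0%N a j)) k =
  if k \in (i : seq nat) then nth 0 a (index k i) else 0.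
Proof.
move=> ui; rewrite cm_prodE.
have -> : \sum_(j < size a) expcmn (ucm (tnth i j)) (nth 0 a j) k =
          \sum_(j < size a) nth 0 a j * (nth 0 i j == k).
  by apply: eq_bigr => j _; rewrite expcmnE ucmE (tnth_nth 0).
case: ifPn => [ki|kNi].
  have lt_k : index k i < size a.
    by move: ki; rewrite -index_mem size_tuple.
  rewrite (bigD1 (Ordinal lt_k)) //= nth_index // eqxx muln1 big1 ?addn0 //.
  move=> j /negP jk; case: eqP => [ij|]; last by rewrite muln0.
  by case: jk; apply/eqP/val_inj; rewrite /= -ij index_uniq // size_tuple.
rewrite big1 // => j _; case: eqP => [ij|]; last by rewrite muln0.
by rewrite -ij mem_nth ?size_tuple in kNi.
Qed.

(** * The monomial quasi-symmetric function in which a given monomial occurs *)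

Section Exponents.

Variable m : {cmonom nat}.

Definition exp_vars : seq nat := sort leq (finsupp m).

Definition exp_composition : seq nat := [seq m j | j <- exp_vars].

Lemma exp_vars_sorted : sorted ltn exp_vars.
Proof.
rewrite ltn_sorted_uniq_leq sort_uniq fset_uniq sort_sorted //.
exact: leq_total.
Qed.

Lemma exp_vars_uniq : uniq exp_vars.
Proof. by rewrite sort_uniq fset_uniq. Qed.

Lemma mem_exp_vars k : (k \in exp_vars) = (m k != 0).
Proof. by rewrite mem_sort cmE_neq0. Qed.

Lemma exp_composition_neq0 : 0 \notin exp_composition.
Proof. by apply/mapP => -[k]; rewrite mem_exp_vars => /eqP mk /esym. Qed.

Lemma nth_exp_composition i : i < size exp_composition ->
  nth 0 exp_composition i = m (nth 0 exp_vars i).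
Proof. by move=> lti; rewrite (nth_map 0) // -(size_map m). Qed.

(** The index ranges over ['I_(size exp_composition)], not over the equal bound [size exp_vars],
    because this type indexes the blocks counted by [zeta B exp_composition]. *)
Lemma exp_vars_nth k : m k != 0 ->
  exists i : 'I_(size exp_composition), nth 0 exp_vars i = k.
Proof.
rewrite -mem_exp_vars => ks.
have lt_k : index k exp_vars < size exp_composition.
  by rewrite size_map index_mem.
by exists (Ordinal lt_k); rewrite nth_index.
Qed.

Lemma exp_vars_inj :
  injective (fun i : 'I_(size exp_composition) => nth 0 exp_vars i).
Proof.
move=> i j /eqP; rewrite nth_uniq ?exp_vars_uniq -?(size_map m exp_vars) //.
by move/eqP/val_inj.
Qed.

Lemma composition_monomial_eq (a : seq nat) (i : (size a).-tuple nat) :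
  0 \notin a -> sorted ltn i ->
  (m == \big[mmul/mone]_(j < size a) expcmn (ucm (tnth i j)) (nth 0%N a j)) =
  (a == exp_composition) && (i == exp_vars :> seq nat).
Proof.
move=> a0 si.
have ui : uniq i := sorted_uniq ltn_trans ltnn si.
have si_a : size i = size a := size_tuple i.
apply/cmP/andP => [mE|[/eqP aE /eqP iE] k]; last first.
  rewrite composition_monomialE // iE mem_exp_vars.
  case: eqP => // /eqP; rewrite -mem_exp_vars => ki.
  by rewrite aE (nth_map 0) ?index_mem // nth_index.
(* As [a] has no zero part, every entry of [i] has a nonzero exponent. Hence [i] and [exp_vars] are
   strictly increasing with the same members. *)
have iE : i = exp_vars :> seq nat.
  apply: (irr_sorted_eq ltn_trans ltnn si exp_vars_sorted) => k.
  rewrite mem_exp_vars mE composition_monomialE //; case: ifPn => // ki.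
  apply/esym; apply: contraNneq a0 => <-.
  by move: ki; rewrite -index_mem si_a => /mem_nth.
split; last exact/eqP.
apply/eqP/(@eq_from_nth _ 0) => [|j lt_j].
  by rewrite -si_a iE size_map.
rewrite nth_exp_composition ?size_map -?iE ?si_a // mE composition_monomialE //.
by rewrite mem_nth ?si_a // index_uniq ?si_a.
Qed.

Local Open Scope ring_scope.

Lemma monomial_qsym_coef (a : seq nat) :
  0%N \notin a -> monomial_qsym a m = (a == exp_composition)%:R.
Proof.
move=> a0; rewrite /monomial_qsym /fps_sum /fps_monomial.
case: eqP => [aE|/eqP aE]; last first.
  by apply: fsbig1 => i si; rewrite composition_monomial_eq // (negPf aE).
(* The only index tuple that contributes is [exp_vars], recast as a tuple of length [size a]. *)
have sa : size exp_vars == size a by rewrite aE size_map.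
rewrite (fsbigE [:: Tuple sa]) //=; first last.
- move=> i si; rewrite inE -val_eqE /= composition_monomial_eq // => /negPf->.
  by rewrite andbF.
- by move=> i /=; rewrite inE => /eqP->; exact: exp_vars_sorted.
rewrite big_cons big_nil ifT; last by rewrite in_setE; exact: exp_vars_sorted.
rewrite composition_monomial_eq // ?exp_vars_sorted //=.
by rewrite eqxx andbT aE eqxx addr0.
Qed.

End Exponents.

(** * Comparison of the coefficients on the two sides *)

Section Decompositions.

Variable X : finType.
Implicit Types (B C : {set {set X}}) (m : {cmonom nat}).

(** The blocks are disjoint and cover [X], so their sizes add up to [#|X|]. Hence [zeta B a]
    vanishes when [a] has any other sum. *)
Lemma decomposition_card B (a : seq nat) (J : {ffun 'I_(size a) -> {set X}}) :
  decomposition B J -> sumn a = #|X|.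
Proof.
case/and4P=> /forallP dJ /eqP covJ /forallP cardJ _.
rewrite -cardsT -covJ -sum1_card.
rewrite partition_disjoint_bigcup /=.
  rewrite sumnE (big_nth 0) big_mkord; apply: eq_bigr => i _.
  by rewrite sum1_card (eqP (cardJ i)).
by move=> i j ij; have /forallP/(_ j)/implyP/(_ ij) := dJ i.
Qed.

Local Open Scope ring_scope.

Lemma Psi_building_coef B m :
  Psi_building B m = (zeta B (exp_composition m))%:R.
Proof.
rewrite /Psi_building /fps_sum.
have aN0 := exp_composition_neq0 m.
transitivity (\sum_(a \in [set a | composition #|X| a]%classic)
    ((zeta B a)%:R * (a == exp_composition m)%:R : int)).
  apply: eq_fsbigr => a; rewrite in_setE => /andP[a0 _].
  by rewrite monomial_qsym_coef.
(* The larger index set contains [exp_composition m] whatever the degree of [m]; the added terms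
   have [zeta B a = 0] by [decomposition_card]. *)
rewrite (fsbig_widen _ [set a : seq nat | 0%N \notin a]%classic) /=.
- rewrite (fsbigE [:: exp_composition m]) //=.
  + by rewrite big_cons big_nil ifT ?in_setE // eqxx mulr1 addr0.
  + by move=> a /=; rewrite inE => /eqP->.
  + by move=> a _; rewrite inE => /negPf->; rewrite mulr0.
- by move=> a /andP[].
move=> a [/= a0 /negP]; rewrite /composition a0 /= => na.
rewrite /zeta (eq_card0 (A := _)) ?mul0r // => J; rewrite inE.
by apply/negP => /decomposition_card /eqP; apply/negP.
Qed.

(** Only the colors occurring in [m] are recorded; when [f] has monomial [m], its other fibres are
    empty. *)
Definition coloring_fibres m (f : {ffun X -> nat}) :
    {ffun 'I_(size (exp_composition m)) -> {set X}} :=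
  [ffun i : 'I_(size (exp_composition m)) =>
     [set x | f x == nth 0%N (exp_vars m) i]%SET].

(** The condition on fibre sizes says that the monomial of [f] is [m]. Injectivity holds because
    each color used then occurs in [m], so the recorded fibres determine [f]. *)
Lemma coloring_fibres_bij B C m :
  building_set B -> generates B C ->
  set_bij [set f | proper_coloring (minimal_elements C) f /\
                   forall k, #|[set x | f x == k]%SET| = m k]%classic
          [set` [set J | decomposition (a := exp_composition m) B J]%SET]
          (coloring_fibres m).
Proof.
move=> bB gC.
have C2 : {in minimal_elements C, forall S : {set X}, (1 < #|S|)%N}.
  move=> S; rewrite inE => /minsetP[SC _].
  by case/andP: gC => /forall_inP/(_ S SC).
have var_of (f : {ffun X -> nat}) x :
    (forall k, #|[set x | f x == k]%SET| = m k) ->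
    exists i : 'I_(size (exp_composition m)), nth 0%N (exp_vars m) i = f x.
  move=> fm; apply: exp_vars_nth; rewrite -fm -lt0n card_gt0.
  by apply/set0Pn; exists x; rewrite inE.
split=> [f [/(proper_coloringP _ C2) pf fm]|f g|J] /=.
- rewrite inE; apply/and4P; split.
  + apply/forallP => i; apply/forallP => j; apply/implyP => ij.
    rewrite -setI_eq0; apply/eqP/setP => x; rewrite !ffunE !inE.
    apply: contraNF ij => /andP[/eqP-> /eqP/exp_vars_inj->] //.
  + rewrite -subTset; apply/subsetP => x _; apply/bigcupP.
    by have [i ix] := var_of f x fm; exists i; rewrite // ffunE inE ix.
  + by apply/forallP => i; rewrite ffunE fm nth_exp_composition.
  + apply/forallP => i; rewrite (restriction_discrete _ bB gC) ffunE.
    by apply/forall_inP => S SC; exact: pf.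
- rewrite !in_setE => -[_ fm] _ efg; apply/ffunP => x.
  have [i ix] := var_of f x fm.
  have : x \in coloring_fibres m f i by rewrite ffunE inE ix.
  by rewrite efg ffunE inE ix => /eqP.
rewrite inE => /and4P[/forallP dJ /eqP covJ /forallP cJ /forallP rJ].
have /fin_all_exists[g gJ] x : exists i, x \in J i.
  have : x \in \bigcup_i J i by rewrite covJ inE.
  by case/bigcupP => i _; exists i.
have memJ x i : (x \in J i) = (g x == i).
  apply/idP/eqP => [xJ|<- //]; apply/eqP; apply: contraT => gi.
  have /forallP/(_ i)/implyP/(_ gi)/disjointFr/(_ (gJ x)) := dJ (g x).
  by rewrite xJ.
(* The preimage of [J] gives the points of block [i] the [i]-th variable of [m] as color; [g x] is
   the block of [x]. *)
pose f := [ffun x => nth 0%N (exp_vars m) (g x)].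
have fib (i : 'I_(size (exp_composition m))) :
    [set x | f x == nth 0%N (exp_vars m) i]%SET = J i.
  apply/setP => x; rewrite inE memJ ffunE.
  by apply/eqP/eqP => [/exp_vars_inj|->].
exists f; last by apply/ffunP => i; rewrite ffunE fib.
split.
  apply/proper_coloringP => // k S SC; apply/negP => Sk.
  have /set0Pn[x xS] : S != set0 by rewrite -card_gt0 ltnW // C2.
  have /forall_inP/(_ S SC)/negP :
      [forall S in minimal_elements C, ~~ (S \subset J (g x))].
    by rewrite -(restriction_discrete _ bB gC).
  apply; rewrite -fib; have := subsetP Sk x xS.
  by rewrite inE [X in X == k]ffunE => /eqP->.
(* A color absent from [m] has an empty fibre, as [f] takes its values in [exp_vars m]; any other
   fibre is a block of [J]. *)
move=> k; case: (eqVneq (m k) 0%N) => [mk|/exp_vars_nth[i <-]].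
  rewrite mk; apply: eq_card0 => x; rewrite inE ffunE.
  apply/negP => /eqP gk; have : k \in exp_vars m.
    have := ltn_ord (g x).
    by rewrite -gk [X in (_ < X)%N]size_map => /mem_nth->.
  by rewrite mem_exp_vars mk.
by rewrite fib (eqP (cJ i)) nth_exp_composition.
Qed.

Lemma Psi_hypergraph_coef B C m :
  building_set B -> generates B C ->
  Psi_hypergraph (minimal_elements C) m = (zeta B (exp_composition m))%:R.
Proof.
move=> bB gC; have bij_fibres := coloring_fibres_bij m bB gC.
rewrite /Psi_hypergraph /fps_sum.
transitivity (\sum_(f \in [set f | proper_coloring (minimal_elements C) f /\
    forall k, #|[set x | f x == k]%SET| = m k]%classic) (1 : int)).
  rewrite [RHS]fsbig_mkcondr; apply: eq_fsbigr => f _.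
  rewrite /fps_monomial; case: cmP => [mE|mN].
    by rewrite ifT // in_setE => k; rewrite mE coloring_monomialE.
  rewrite ifF //; apply/negP; rewrite in_setE => fm; apply: mN => k.
  by rewrite coloring_monomialE fm.
(* The coefficient is now a sum of ones over the colorings with monomial [m]; the bijection turns it
   into a count of decompositions. *)
rewrite -(reindex_fsbig _ _ _ (fun=> 1 : int) bij_fibres).
rewrite -(bigfs _ (index_enum_uniq _)) /= => [|J _].
  by rewrite sumr_const.
by rewrite mem_index_enum.
Qed.

End Decompositions.

Theorem theorem2 (X : finType) (B C : {set {set X}})
    (hB : building_set B) (hC : generating_collection B C) :
  Psi_building B = Psi_hypergraph (minimal_elements C).
Proof.
apply/funext => m; have gBC : generates B C by case/minsetP: hC.
by rewrite Psi_building_coef (Psi_hypergraph_coef m hB gBC).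
Qed.
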